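(* Let $X$ be a finite or countable set, let $\Phi$ be $\mathbb{R}$ or $\mathbb{C}$, let $p : X \times X \to \Phi$ be a function, and let $P$ be the transition operator with kernel $p$ and domain $D(P)$. Then the following assertions are equivalent: (i) $P$ is a continuous linear operator from $l^\infty(X)$ into itself; (ii) $\sup_{x \in X} \sum_{y \in X} |p(x,y)| < \infty$; (iii) $D(P) \supseteq l^\infty(X)$ and $P(l^\infty(X)) \subseteq l^\infty(X)$. If one of the previous conditions holds, then $\|P\| = \sup_{x \in X} \sum_{y \in X} |p(x,y)|$, where $\|P\|$ is the operator norm of $P$ from $l^\infty(X)$ into itself.
   Context: For a finite or countable set $X$, $\Phi \in \{\mathbb{R}, \mathbb{C}\}$ and a function $p : X \times X \to \Phi$, the transition operator $P$ with kernel $p$ and its domain $D(P)$ are defined by $$D(P) := \Big\{ f : X \to \Phi \ : \ \sum_{y \in X} |p(x,y)|\,|f(y)| < +\infty \ \text{ for all } x \in X \Big\},$$ $$(Pf)(x) := \sum_{y \in X} p(x,y) f(y), \qquad f \in D(P),\ x \in X.$$ Here $l^\infty(X)$ is the Banach space of bounded functions $f : X \to \Phi$ with the supremum norm. Saying that $P$ is a continuous linear operator from $l^\infty(X)$ into itself includes that $P$ is defined on all of $l^\infty(X)$, i.e. $l^\infty(X) \subseteq D(P)$. *)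

(* Defs.v *)
From HB Require Import structures.
From mathcomp Require Import all_boot all_order all_algebra.
From mathcomp Require Import all_classical all_reals all_analysis.
From mathcomp Require Import complex.
From mathcomp.analysis.showcase Require summability.
Set Implicit Arguments.
Unset Strict Implicit.
Unset Printing Implicit Defensive.
Import Order.TTheory GRing.Theory Num.Theory.
Import numFieldNormedType.Exports.
Local Open Scope classical_set_scope.
Local Open Scope ring_scope.
Local Open Scope complex_scope.

Variant scalar_kind := RealScalars | ComplexScalars.

Definition scalar_field (R : realType) (k : scalar_kind) : numFieldType :=
  match k with
  | RealScalars => R
  | ComplexScalars => R[i]
  end.

(* The library norm of a numFieldType takes its values in the field itself,
   whereas suprema and sums of moduli are taken in R. *)
Definition modulus (R : realType) (k : scalar_kind) : scalar_field R k -> R :=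
  match k return scalar_field R k -> R with
  | RealScalars => fun x => `|x|
  | ComplexScalars => @ComplexField.Normc.normc R
  end.

Definition of_real (R : realType) (k : scalar_kind) : R -> scalar_field R k :=
  match k return R -> scalar_field R k with
  | RealScalars => id
  | ComplexScalars => @real_complex R
  end.
Arguments of_real {R} k.

Section scalar_theory.
Context (R : realType) (k : scalar_kind).
Implicit Types (x y : scalar_field R k) (a b : R).

Lemma of_real_modulus x : of_real k (modulus x) = `|x|.
Proof. by case: k x. Qed.

Lemma ler_of_real a b : (of_real k a <= of_real k b) = (a <= b).
Proof. by case: k => //=; rewrite lecR. Qed.

Lemma of_realD a b : of_real k (a + b) = of_real k a + of_real k b.
Proof. by case: k => //=; rewrite rmorphD. Qed.

Lemma of_realM a b : of_real k (a * b) = of_real k a * of_real k b.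
Proof. by case: k => //=; rewrite rmorphM. Qed.

Lemma of_real0 : of_real k 0 = 0 :> scalar_field R k.
Proof. by case: k. Qed.

Lemma of_real_inj : injective (@of_real R k).
Proof. by move=> a b ab; apply/eqP; rewrite eq_le -!ler_of_real ab lexx. Qed.

Lemma modulus_ge0 x : 0 <= modulus x.
Proof. by rewrite -ler_of_real of_real0 of_real_modulus. Qed.

Lemma modulus0 : modulus (0 : scalar_field R k) = 0.
Proof. by apply: of_real_inj; rewrite of_real_modulus normr0 of_real0. Qed.

Lemma modulus0_eq0 x : modulus x = 0 -> x = 0.
Proof. by move=> x0; apply/normr0_eq0; rewrite -of_real_modulus x0 of_real0. Qed.

Lemma modulusM x y : modulus (x * y) = modulus x * modulus y.
Proof. by apply: of_real_inj; rewrite of_realM !of_real_modulus normrM. Qed.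

Lemma ler_modulusD x y : modulus (x + y) <= modulus x + modulus y.
Proof. by rewrite -ler_of_real of_realD !of_real_modulus ler_normD. Qed.

Lemma real_of_realP x : x \is Num.real -> exists a, x = of_real k a.
Proof.
case: k x => [x _|[a b]]; first by exists x.
by move=> /complex_realP[r ->]; exists r.
Qed.

Lemma of_real_real a : of_real k a \is Num.real.
Proof. by case: k => /=; rewrite ?num_real//; apply/complex_realP; exists a. Qed.

End scalar_theory.

Section linfty.
Context (R : realType) (k : scalar_kind) (X : countType).
Implicit Types f g : X -> scalar_field R k.

Definition linfty_set : set (X -> scalar_field R k) := bounded_fun.

Definition bounded_pred : {pred X -> scalar_field R k} := fun f => `[< linfty_set f >].

Lemma bounded_modulusP f :
  bounded_fun f <-> exists M : R, forall x, modulus (f x) <= M.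
Proof.
split=> [/pinfty_ex_gt0[M M_gt0 fM]|[M fM]].
  have /real_of_realP[a aM] := gtr0_real M_gt0.
  by exists a => x; rewrite -(ler_of_real k) of_real_modulus -aM fM.
exists (of_real k M); split; first exact: of_real_real.
move=> N /ltW MN x _; rewrite /= (le_trans _ MN)//.
by rewrite -of_real_modulus ler_of_real.
Qed.

Fact bounded_pred_submod_closed : submod_closed bounded_pred.
Proof.
split=> [|a f g /asboolP/bounded_modulusP[M fM] /asboolP/bounded_modulusP[N gN]].
  by apply/asboolP/bounded_modulusP; exists 0 => x; rewrite modulus0.
apply/asboolP/bounded_modulusP; exists (modulus a * M + N) => x.
rewrite (le_trans (ler_modulusD _ _))// lerD// modulusM.
by rewrite ler_wpM2l// modulus_ge0.
Qed.

HB.instance Definition _ := GRing.isSubmodClosed.Build _ _ bounded_pred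
  bounded_pred_submod_closed.

Record linfty := Linfty {
  linfty_val :> X -> scalar_field R k;
  linfty_valP : linfty_val \in bounded_pred }.

HB.instance Definition _ := [isSub for linfty_val].
HB.instance Definition _ := [Choice of linfty by <:].
HB.instance Definition _ := [SubChoice_isSubLmodule of linfty by <:].

(* For X empty this is sup set0 = 0, as it should be. *)
Definition supnorm (u : linfty) : R := sup (range (fun x => modulus (u x))).

Lemma has_ubound_modulus (u : linfty) : has_ubound (range (fun x => modulus (u x))).
Proof.
have /asboolP/bounded_modulusP[M uM] := linfty_valP u.
by exists M => _ [x _ <-].
Qed.

Lemma modulus_le_supnorm (u : linfty) x : modulus (u x) <= supnorm u.
Proof. by apply: ub_le_sup; [exact: has_ubound_modulus|exists x]. Qed.

Lemma supnormP (u : linfty) : (exists x : X, True) \/ supnorm u = 0.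
Proof.
have [|X0] := pselect (exists x : X, True); [by left|right].
suff e : range (fun x => modulus (u x)) = set0 by rewrite /supnorm e sup0.
by apply/seteqP; split=> // y [x _ _]; exfalso; apply: X0; exists x.
Qed.

Lemma supnorm_le (u : linfty) M :
  0 <= M -> (forall x, modulus (u x) <= M) -> supnorm u <= M.
Proof.
move=> M0 uM; have [[x _]|->//] := supnormP u.
by apply: ge_sup => [|_ [y _ <-]]; [exists (modulus (u x)); exists x|].
Qed.

Lemma supnorm_ge0 (u : linfty) : 0 <= supnorm u.
Proof.
have [[x _]|->//] := supnormP u.
exact: le_trans (modulus_ge0 (u x)) (modulus_le_supnorm u x).
Qed.

Fact ler_supnormD (u v : linfty) :
  of_real k (supnorm (u + v)) <= of_real k (supnorm u) + of_real k (supnorm v).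
Proof.
rewrite -of_realD ler_of_real; apply: supnorm_le => [|x].
  by rewrite addr_ge0 ?supnorm_ge0.
by rewrite (le_trans (ler_modulusD _ _))// lerD ?modulus_le_supnorm.
Qed.

Fact supnormZ (a : scalar_field R k) (u : linfty) :
  of_real k (supnorm (a *: u)) = `|a| * of_real k (supnorm u).
Proof.
rewrite -of_real_modulus -of_realM; congr of_real; apply/eqP.
rewrite eq_le; apply/andP; split.
  apply: supnorm_le => [|x]; first by rewrite mulr_ge0 ?modulus_ge0 ?supnorm_ge0.
  by rewrite modulusM ler_wpM2l ?modulus_ge0 ?modulus_le_supnorm.
have [->|a0] := eqVneq a 0; first by rewrite modulus0 mul0r supnorm_ge0.
have a_gt0 : 0 < modulus a.
  by rewrite lt_neqAle modulus_ge0 andbT eq_sym; apply: contra_neq a0 => /modulus0_eq0.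
rewrite mulrC -ler_pdivlMr//; apply: supnorm_le => [|x].
  by rewrite divr_ge0 ?supnorm_ge0 ?modulus_ge0.
by rewrite ler_pdivlMr// mulrC -modulusM (modulus_le_supnorm (a *: u)).
Qed.

Fact supnorm_eq0 (u : linfty) : of_real k (supnorm u) = 0 -> u = 0.
Proof.
rewrite -(of_real0 R k) => /of_real_inj u0; apply/val_inj/funext => x /=.
apply/modulus0_eq0/eqP; rewrite eq_le modulus_ge0 andbT -u0.
exact: modulus_le_supnorm.
Qed.

HB.instance Definition _ := Lmodule_isNormed.Build (scalar_field R k) linfty
  ler_supnormD supnormZ supnorm_eq0.

End linfty.
Arguments linfty_set : clear implicits.

Section transition_operator.
Context (R : realType) (k : scalar_kind) (X : countType).
Variable p : X -> X -> scalar_field R k.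

Definition trans_dom : set (X -> scalar_field R k) :=
  [set f | forall x,
    (\esum_(y in [set: X]) (modulus (p x y) * modulus (f y))%:E < +oo)%E].

(* [summability.sum] is the limit of the partial sums over the finite subsets
   of X, directed by inclusion. Its value is arbitrary off [trans_dom]. *)
Definition trans_op (f : X -> scalar_field R k) : X -> scalar_field R k :=
  fun x => summability.sum (fun y => p x y * f y).

(* The supremum is taken in [0, +oo]: adjoining 0 only matters for X empty,
   where [ereal_sup set0] would be -oo. *)
Definition sup_row_sums : \bar R :=
  ereal_sup (0%E |`
    range (fun x => \esum_(y in [set: X]) (modulus (p x y))%:E)).

Definition trans_op_restricts_to (T : linfty R k X -> linfty R k X) : Prop :=
  linfty_set R k X `<=` trans_dom /\
  forall u : linfty R k X, (T u : X -> scalar_field R k) = trans_op u.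

End transition_operator.

Definition opnorm (R : realType) (k : scalar_kind) (X : countType)
    (T : linfty R k X -> linfty R k X) : \bar R :=
  ereal_sup [set (supnorm (T u))%:E | u in [set u | supnorm u <= 1]].

(* Main.v *)
Require Import Defs.
From HB Require Import structures.
From mathcomp Require Import all_boot all_order all_algebra.
From mathcomp Require Import finmap.
From mathcomp Require Import all_classical all_reals all_analysis.
From mathcomp Require Import complex lra.
From mathcomp.analysis.showcase Require summability.
Import Order.TTheory GRing.Theory Num.Theory.
Import numFieldNormedType.Exports.
Local Open Scope classical_set_scope.
Local Open Scope ring_scope.
Set Implicit Arguments.
Unset Strict Implicit.

(** Once the row sums are at most [S], everything is an estimate on absolutely
    convergent sums: [|(Pf)(x)| <= S * |f|], so [P] is bounded on l^oo with norm
    at most [S]. No smaller bound works, which is seen row by row: testing [P] on the bounded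
    function [y |-> |p(x,y)| / p(x,y)], which turns every product
    [p(x,y) * f(y)] into [|p(x,y)|], recovers the whole sum of the row [x].

    The substance is that [P] cannot preserve l^oo with unbounded row sums.
    This is an instance of the uniform boundedness principle, proved here by a
    gliding hump. Testing on the constant 1 shows that each row is summable, and testing on
    indicators of points shows that each column is bounded. If the row sums
    are unbounded, choose inductively rows [x_n] and increasing finite
    sets [F_n] such that the row [x_n] has nearly all of its mass in [F_(n+1)],
    while its mass in [F_n], controlled by the column bounds, is small compared
    to its total. On the hump [F_(n+1) \ F_n] let [f] be the phase of the
    row [x_n]. The humps are disjoint, so that this defines one function [f]
    with [|f| <= 1]; and [|(Pf)(x_n)|] is at least the mass on the hump minus
    the mass elsewhere ([phase_lower_bound]), hence at least [n]. So [Pf] is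
    unbounded.

    Sums over [X] are limits of the finite partial sums. They exist for real
    nonnegative families by monotonicity, for real families as differences of
    such, and for complex ones through real and imaginary parts. *)

(** * Absolutely convergent sums of scalars *)

Section unconditional_sums.
Context {R : realType} {X : countType}.
Local Notation total_sum := summability.sum.
Local Notation partial_sum := summability.partial_sum.
Local Notation totally := summability.totally.
#[local] Existing Instance summability.totally_filter.

Lemma partial_sumE (V : zmodType) (f : X -> V) (A : {fset X}) :
  partial_sum f A = \sum_(y <- A) f y.
Proof. by rewrite big_seq_fsetE. Qed.

Lemma totally_fsubset (A : {fset X}) : \forall B \near totally, (A `<=` B)%fset.
Proof. by exists A. Qed.

Lemma sum_fsetD (V : nmodType) (f : X -> V) (A B : {fset X}) : (A `<=` B)%fset ->
  \sum_(y <- B) f y = \sum_(y <- A) f y + \sum_(y <- (B `\` A)%fset) f y.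
Proof.
move=> AB; rewrite (big_fsetID _ (mem A) B)/=; congr (_ + _); apply: eq_fbigl => y.
  rewrite !inE/=; apply/andP/idP => [[]//|yA]; split=> //.
  exact: (fsubsetP AB).
by rewrite !inE/= andbC.
Qed.

Lemma ler_sum_fsubset (f : X -> R) (A B : {fset X}) : (forall y, 0 <= f y) ->
  (A `<=` B)%fset -> \sum_(y <- A) f y <= \sum_(y <- B) f y.
Proof. by move=> f0 AB; rewrite (sum_fsetD _ AB) lerDl sumr_ge0. Qed.

Lemma fset_sum_le_esum (g : X -> R) (A : {fset X}) : (forall y, 0 <= g y) ->
  ((\sum_(y <- A) g y)%:E <= \esum_(y in [set: X]) (g y)%:E)%E.
Proof.
move=> g0; apply: esum_ge; exists [set` A]; first by split.
by rewrite fsbig_finite//= set_fsetK sumEFin.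
Qed.

Lemma esum_le_fset_sum (g : X -> R) (M : \bar R) :
  (forall A : {fset X}, (\sum_(y <- A) g y)%:E <= M)%E ->
  (\esum_(y in [set: X]) (g y)%:E <= M)%E.
Proof.
move=> gM; apply: ge_ereal_sup => _ [A [finA _] <-].
by rewrite fsbig_finite//= sumEFin.
Qed.

Lemma esum_ltyP (g : X -> R) : (forall y, 0 <= g y) ->
  (\esum_(y in [set: X]) (g y)%:E < +oo)%E <->
  exists M, forall A : {fset X}, \sum_(y <- A) g y <= M.
Proof.
move=> g0; split=> [|[M gM]]; last first.
  by apply: le_lt_trans (ltry M); apply: esum_le_fset_sum => A; rewrite lee_fin.
have := @esum_ge0 R X setT (fun y => (g y)%:E) (fun y _ => g0 y).
case e : (esum _ _) => [M| |]// _ _.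
by exists M => A; rewrite -lee_fin -e fset_sum_le_esum.
Qed.

Lemma cvg_partial_sum_ge0 (f : X -> R) (M : R) : (forall y, 0 <= f y) ->
  (forall A : {fset X}, \sum_(y <- A) f y <= M) ->
  cvg (partial_sum f @ totally).
Proof.
move=> f0 fM; pose E := range (fun A : {fset X} => \sum_(y <- A) f y).
have supE : has_sup E.
  by split; [exists (\sum_(y <- fset0) f y); exists fset0|exists M => _ [A _ <-]].
apply/cvg_ex; exists (sup E); apply/cvgrPdist_le => e e0.
have [_ [A _ <-] eA] := sup_adherent e0 supE.
near=> B.
have AB : (A `<=` B)%fset by near: B; exact: totally_fsubset.
have BE : \sum_(y <- B) f y <= sup E by apply: ub_le_sup; [exact: supE.2|exists B].
rewrite partial_sumE ger0_norm ?subr_ge0// lerBlDr -lerBlDl ltW//.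
exact: lt_le_trans (ler_sum_fsubset _ AB).
Unshelve. all: by end_near. Qed.

(** [f = (|f| + f) - |f|] is a difference of nonnegative summable families. *)
Lemma cvg_partial_sum_real (f : X -> R) (M : R) :
  (forall A : {fset X}, \sum_(y <- A) `|f y| <= M) ->
  cvg (partial_sum f @ totally).
Proof.
move=> fM.
have cabs : cvg (partial_sum (fun y => `|f y|) @ totally).
  exact: cvg_partial_sum_ge0 fM.
have cpos : cvg (partial_sum (fun y => `|f y| + f y) @ totally).
  apply: (@cvg_partial_sum_ge0 _ (M + M)) => [y|A].
    by rewrite -lerBlDl sub0r lerNl -normrN ler_norm.
  by rewrite big_split lerD// (le_trans _ (fM A))// ler_sum// => y _; exact: ler_norm.
suff -> : partial_sum f = partial_sum (fun y => `|f y| + f y) - partial_sum (fun y => `|f y|).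
  exact: is_cvgB.
apply/funext => A; rewrite -[RHS]/(partial_sum _ A - partial_sum _ A).
by rewrite !partial_sumE big_split addrC addKr.
Qed.

Variable k : scalar_kind.
Local Notation K := (scalar_field R k).
Implicit Types (f g q u : X -> K) (A B H : {fset X}).

Lemma lt0r_of_real (d : R) : (0 < of_real k d) = (0 < d).
Proof.
by rewrite !lt_neqAle -{2}(of_real0 R k) ler_of_real -{1}(of_real0 R k)
  (inj_eq (@of_real_inj R k)).
Qed.

Lemma of_realN (a : R) : of_real k (- a) = - of_real k a.
Proof. by apply/eqP; rewrite -addr_eq0 -of_realD addNr of_real0. Qed.

Lemma of_realB (a b : R) : of_real k (a - b) = of_real k a - of_real k b.
Proof. by rewrite of_realD of_realN. Qed.

Lemma of_real_sum (g : X -> R) A :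
  of_real k (\sum_(y <- A) g y) = \sum_(y <- A) of_real k (g y).
Proof. by apply: big_morph => [a b|]; [exact: of_realD|exact: of_real0]. Qed.

Lemma modulus_of_real (a : R) : modulus (of_real k a) = `|a|.
Proof.
case: k => //=; rewrite /ComplexField.Normc.normc/=.
by rewrite expr0n/= addr0 sqrtr_sqr.
Qed.

Lemma cvg_of_real (T : Type) (F : set_system T) (g : T -> R) (l : R) :
  Filter F -> g @ F --> l -> (fun t => of_real k (g t)) @ F --> of_real k l.
Proof.
move=> FF /cvgrPdist_le gl; apply/cvgrPdist_le => e e0.
have /real_of_realP[d de] := gtr0_real e0; rewrite {}de lt0r_of_real in e0 *.
near do rewrite -of_realB -of_real_modulus modulus_of_real ler_of_real.
exact: gl.
Unshelve. all: by end_near. Qed.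

Lemma modulus_sum f A : modulus (\sum_(y <- A) f y) <= \sum_(y <- A) modulus (f y).
Proof.
elim/big_ind2: _ => [|x a y b xa yb|//]; first by rewrite modulus0.
by rewrite (le_trans (ler_modulusD _ _))// lerD.
Qed.

(** Absolute summability with an explicit bound. Working with bounds on finite
    sums, rather than with the value of the extended sum, keeps the estimates
    below inside [R]. *)
Definition summable_by f (M : R) := forall A, \sum_(y <- A) modulus (f y) <= M.

(** Reduces convergence over either scalar field to convergence of real families:
    the two families are the real and imaginary parts of a complex one. *)
Lemma scalar_decomposition f : exists g h : X -> R, exists c : K,
  [/\ forall y, f y = of_real k (g y) + c * of_real k (h y),
      forall y, `|g y| <= modulus (f y) &
      forall y, `|h y| <= modulus (f y)].
Proof.
case: k f => f /=.
  by exists f, (cst 0), 0; split=> // y; rewrite ?mul0r ?addr0// normr0.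
exists (fun y => complex.Re (f y)), (fun y => complex.Im (f y)), 'i%C.
split=> y; first exact: complexE.
  case: (f y) => a b /=.
  by rewrite -sqrtr_sqr ler_sqrt ?lerDl ?addr_ge0 ?sqr_ge0.
case: (f y) => a b /=.
by rewrite -sqrtr_sqr ler_sqrt ?lerDr ?addr_ge0 ?sqr_ge0.
Qed.

Lemma partial_sumD f g : partial_sum (f \+ g) = partial_sum f + partial_sum g.
Proof. by apply/funext => A; rewrite fctE !partial_sumE big_split. Qed.

Lemma partial_sumZ (c : K) f :
  partial_sum (fun y => c * f y) = (fun A => c * partial_sum f A).
Proof. by apply/funext => A; rewrite !partial_sumE mulr_sumr. Qed.

Lemma is_cvg_partial_sum f M : summable_by f M -> cvg (partial_sum f @ totally).
Proof.
move=> fM; have [g [h [c [fE gf hf]]]] := scalar_decomposition f.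
have bnd (r : X -> R) : (forall y, `|r y| <= modulus (f y)) ->
    cvg (partial_sum (fun y => of_real k (r y)) @ totally).
  move=> rf; have /cvg_ex[/= l rl] : cvg (partial_sum r @ totally).
    apply: (@cvg_partial_sum_real _ M) => A.
    by rewrite (le_trans _ (fM A))// ler_sum.
  apply/cvg_ex; exists (of_real k l).
  have -> : partial_sum (fun y => of_real k (r y)) = fun A => of_real k (partial_sum r A).
    by apply/funext => A; rewrite !partial_sumE of_real_sum.
  exact: cvg_of_real.
have -> : f = (fun y => of_real k (g y)) \+ (fun y => c * of_real k (h y)).
  exact/funext.
rewrite partial_sumD partial_sumZ; apply: is_cvgD; first exact: bnd.
by apply: is_cvgMl_tmp; exact: bnd.
Qed.

Lemma cvg_total_sum f M : summable_by f M ->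
  partial_sum f @ totally --> total_sum f.
Proof. by move=> fM; exact: is_cvg_partial_sum fM. Qed.

Lemma total_sum_eq f (s : K) : partial_sum f @ totally --> s -> total_sum f = s.
Proof. by move=> fs; apply: cvg_lim => //; exact: norm_hausdorff. Qed.

Lemma total_sum_linear f g (c : K) M N : summable_by f M -> summable_by g N ->
  total_sum (fun y => c * f y + g y) = c * total_sum f + total_sum g.
Proof.
move=> fM gN; apply: total_sum_eq.
rewrite [X in X @ _](_ : _ = (fun A => c * partial_sum f A) + partial_sum g).
  by apply: cvgD; [apply: cvgMl_tmp|]; exact: cvg_total_sum.
by rewrite -partial_sumZ -partial_sumD.
Qed.

(** Estimates on an infinite sum are obtained from finite ones through this
    approximation; [A] lets the finite set contain any prescribed points. *)
Lemma total_sum_approx f M A e : summable_by f M -> 0 < e ->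
  exists2 B, (A `<=` B)%fset & modulus (total_sum f - \sum_(y <- B) f y) <= e.
Proof.
move=> /cvg_total_sum/cvgrPdist_le fs e0.
have /fs near_s : 0 < of_real k e by rewrite lt0r_of_real.
have /filter_ex[B [AB sB]] : \forall B \near totally, (A `<=` B)%fset /\
    `|total_sum f - partial_sum f B| <= of_real k e.
  by apply: filterI near_s; exact: totally_fsubset.
exists B => //; rewrite -(ler_of_real k) of_real_modulus.
by move: sB => /=; rewrite partial_sumE.
Qed.

Lemma modulus_total_sum_le f M : summable_by f M -> modulus (total_sum f) <= M.
Proof.
move=> fM; apply/ler_addgt0Pl => e e0.
have [B _ sB] := total_sum_approx fset0 fM e0.
rewrite -(subrK (\sum_(y <- B) f y) (total_sum f)).
by rewrite (le_trans (ler_modulusD _ _))// lerD// (le_trans (modulus_sum _ _)).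
Qed.

Lemma total_sum_single f x : (forall y, y != x -> f y = 0) -> total_sum f = f x.
Proof.
move=> f0; apply: total_sum_eq; apply: cvg_near_cst.
near=> A; have xA : ([fset x] `<=` A)%fset by near: A; exact: totally_fsubset.
rewrite partial_sumE (sum_fsetD _ xA) big_seq_fset1 big_seq big1 ?addr0// => y.
by rewrite !inE => /andP[/f0].
Unshelve. all: by end_near. Qed.

(** The conjugate of the sign of [z]; zero when [z] is zero. *)
Definition phase (z : K) : K := of_real k (modulus z) / z.

Lemma modulus_phase z : modulus (phase z) <= 1.
Proof.
have [->|z0] := eqVneq z 0; first by rewrite /phase invr0 mulr0 modulus0.
rewrite -(ler_of_real k) of_real_modulus normrM normfV of_real_modulus normr_id.
by rewrite divff ?normr_eq0//; case: k.
Qed.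

Lemma mul_phase z : z * phase z = of_real k (modulus z).
Proof.
have [->|z0] := eqVneq z 0; first by rewrite mul0r modulus0 of_real0.
by rewrite mulrC divfK.
Qed.

Lemma summable_byM q u M C : (forall y, modulus (u y) <= C) ->
  summable_by q M -> 0 <= C -> summable_by (fun y => q y * u y) (M * C).
Proof.
move=> uC qM C0 A; rewrite (@le_trans _ _ ((\sum_(y <- A) modulus (q y)) * C))//.
  by rewrite mulr_suml ler_sum// => y _; rewrite modulusM ler_wpM2l ?modulus_ge0.
by rewrite ler_wpM2r.
Qed.

(** On [H] the products add up to the full mass [h] of [q] on [H]; elsewhere
    they cannot cancel more than the remaining mass, at most [M - h]. So the sum
    has modulus at least [h - (M - h)]. *)
Lemma phase_lower_bound q u H M : summable_by q M ->
  (forall y, modulus (u y) <= 1) -> {in H, forall y, u y = phase (q y)} ->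
  2 * \sum_(y <- H) modulus (q y) - M <= modulus (total_sum (fun y => q y * u y)).
Proof.
move=> qM u1 uH; apply/ler_addgt0Pl => e e0.
have quM := summable_byM u1 qM ler01.
have [B HB sB] := total_sum_approx H quM e0.
set s := total_sum _ in sB *; set t := \sum_(y <- B) _ in sB.
have hH : \sum_(y <- H) q y * u y = of_real k (\sum_(y <- H) modulus (q y)).
  rewrite of_real_sum big_seq [RHS]big_seq; apply: eq_bigr => y yH.
  by rewrite uH// mul_phase.
pose h := \sum_(y <- H) q y * u y; pose r := \sum_(y <- (B `\` H)%fset) q y * u y.
have tE : t = h + r by exact: sum_fsetD.
have hm : modulus h = \sum_(y <- H) modulus (q y).
  by rewrite /h hH modulus_of_real ger0_norm// sumr_ge0// => y _; exact: modulus_ge0.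
have rm : modulus r <= \sum_(y <- (B `\` H)%fset) modulus (q y).
  rewrite (le_trans (modulus_sum _ _))// ler_sum// => y _.
  by rewrite modulusM ler_piMr// modulus_ge0.
have modulusN (z : K) : modulus (- z) = modulus z.
  by apply: (@of_real_inj R k); rewrite !of_real_modulus normrN.
have hle : modulus h <= modulus s + e + modulus r.
  rewrite (_ : h = s + (- (s - t)) + (- r)); last by rewrite tE opprB addrCA subrr addr0 addrK.
  rewrite (le_trans (ler_modulusD _ _))// modulusN lerD2r.
  by rewrite (le_trans (ler_modulusD _ _))// modulusN lerD2l.
have := qM B; rewrite (sum_fsetD _ HB) => BM.
lra.
Qed.

(** [phase_lower_bound] is only useful when [M] is close to the mass of some
    finite set; the supremum of the finite sums is such a bound. *)
Lemma sharp_bound f M : summable_by f M ->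
  exists2 S, summable_by f S & forall e, 0 < e ->
    exists A : {fset X}, S - e < \sum_(y <- A) modulus (f y).
Proof.
move=> fM; pose E := range (fun A : {fset X} => \sum_(y <- A) modulus (f y)).
have supE : has_sup E.
  by split; [exists (\sum_(y <- fset0) modulus (f y)); exists fset0|exists M => _ [A _ <-]].
exists (sup E) => [A|e e0]; first by apply: ub_le_sup; [exact: supE.2|exists A].
by have [_ [A _ <-]] := sup_adherent e0 supE; exists A.
Qed.

Lemma sum_modulus_le_phase q M A : summable_by q M ->
  \sum_(y <- A) modulus (q y) <= modulus (total_sum (fun y => q y * phase (q y))).
Proof.
move=> /sharp_bound[S qS Sq]; apply/ler_addgt0Pl => e e0.
have [B SB] := Sq _ (divr_gt0 e0 (@ltr0Sn R 1)).
have := phase_lower_bound (u := fun y => phase (q y)) (H := B) qS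
  (fun y => modulus_phase (q y)) (fun y _ => erefl).
have := qS A; lra.
Qed.

End unconditional_sums.

(** * The gliding hump *)

Section gliding_hump.
Context {R : realType} {X : countType} {k : scalar_kind}.
Variable p : X -> X -> scalar_field R k.
Implicit Types (G : {fset X}).

Hypothesis rows_summable : forall x, exists M, summable_by (p x) M.
Hypothesis columns_bounded : forall y, exists N, forall x, modulus (p x y) <= N.
Hypothesis rows_unbounded :
  forall S, exists x (A : {fset X}), S < \sum_(y <- A) modulus (p x y).

(** The new row is taken so heavy that, even after twice the column bounds on
    [G] and twice the mass missed by [F] (at most 1) are discarded,
    [phase_lower_bound] on the hump [F \ G] still gives [n]. *)
Lemma next_hump (n : nat) G : exists xF : X * {fset X}, (G `<=` xF.2)%fset /\
  exists2 S, summable_by (p xF.1) S &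
    n%:R <= 2 * \sum_(y <- (xF.2 `\` G)%fset) modulus (p xF.1 y) - S.
Proof.
have [N pN] := choice columns_bounded.
(* On F the mass is at least S - 1, and on G at most the sum of the column
   bounds N; hence 2 * (mass on the hump) - S >= S - 2 * sum_G N - 2. *)
have [x [B xB]] := rows_unbounded (n%:R + 2 * \sum_(y <- G) N y + 2).
have [M /sharp_bound[S xS /(_ 1 ltr01)[A SA]]] := rows_summable x.
exists (x, G `|` A)%fset; split; first exact: fsubsetUl.
exists S => //=.
have xG : \sum_(y <- G) modulus (p x y) <= \sum_(y <- G) N y by apply: ler_sum.
have := sum_fsetD (fun y => modulus (p x y)) (fsubsetUl G A) => GA.
have AGA : \sum_(y <- A) modulus (p x y) <= \sum_(y <- (G `|` A)%fset) modulus (p x y).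
  by apply: ler_sum_fsubset; [move=> y; exact: modulus_ge0|exact: fsubsetUr].
have := xS B.
lra.
Qed.

(** The function [u] is built from all humps at once: on the [n]-th one it is the
    phase of the [n]-th row, and it vanishes elsewhere. *)
Lemma gliding_hump : exists u : X -> scalar_field R k,
  (forall y, modulus (u y) <= 1) /\
  forall n : nat, exists x, n%:R <= modulus (trans_op p u x).
Proof.
have [next nextP] := choice (fun nG : nat * {fset X} => next_hump nG.1 nG.2).
pose F := fix F n := if n is m.+1 then (next (m, F m)).2 else fset0.
pose x n := (next (n, F n)).1.
have FS n : (F n `<=` F n.+1)%fset by have [] := nextP (n, F n).
have F_homo : {homo F : m n / (m <= n)%N >-> (m `<=` n)%fset}.
  by apply: homo_leq => [A|B A C|//]; [exact: fsubset_refl|exact: fsubset_trans].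
have hump_lt y m n : y \in F m.+1 -> y \notin F n -> (n <= m)%N.
  move=> ym yn; rewrite leqNgt; apply: contra yn => mn.
  by apply: fsubsetP ym; exact: F_homo.
(* The humps are pairwise disjoint, so at most one index applies to y. *)
pose u y := if pselect (exists n, y \in (F n.+1 `\` F n)%fset) is left h
  then phase (p (x (projT1 (cid h))) y) else 0.
have u1 y : modulus (u y) <= 1.
  by rewrite /u; case: pselect => [?|_]; [exact: modulus_phase|rewrite modulus0].
exists u; split=> // n; exists (x n).
have [_ [S xS nS]] := nextP (n, F n).
apply: le_trans nS _; apply: phase_lower_bound => // y yn.
rewrite /u; case: pselect => [h|[]]; last by exists n.
case: cid => m /=; move: yn; rewrite /= !inE => /andP[yn yn1] /andP[ym ym1].
suff -> : m = n by [].
by apply/eqP; rewrite eqn_leq (hump_lt y n m)// (hump_lt y m n).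
Qed.

End gliding_hump.

(** * The operator on bounded functions *)

Section operator.
Context {R : realType} {X : countType} {k : scalar_kind}.
Variable p : X -> X -> scalar_field R k.
Local Notation K := (scalar_field R k).
Implicit Types (f : X -> K) (A : {fset X}) (S : R).

Lemma trans_dom_summable f : trans_dom p f <->
  forall x, exists M, summable_by (fun y => p x y * f y) M.
Proof.
have pfE x A : \sum_(y <- A) modulus (p x y * f y) =
    \sum_(y <- A) (modulus (p x y) * modulus (f y)).
  by apply: eq_bigr => y _; rewrite modulusM.
have pf0 x y : 0 <= modulus (p x y) * modulus (f y).
  by rewrite mulr_ge0 ?modulus_ge0.
split=> pf x.
  have /(esum_ltyP (pf0 x))[M pM] := pf x.
  by exists M => A; rewrite pfE.
by apply/(esum_ltyP (pf0 x)); have [M pM] := pf x; exists M => A; rewrite -pfE.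
Qed.

Lemma sup_row_sums_ge0 : (0 <= sup_row_sums p)%E.
Proof. by apply: ereal_sup_ubound; left. Qed.

Lemma le_sup_row_sums x A : ((\sum_(y <- A) modulus (p x y))%:E <= sup_row_sums p)%E.
Proof.
have row0 y : 0 <= modulus (p x y) := modulus_ge0 (p x y).
apply: (le_trans (fset_sum_le_esum A row0)).
by apply: ereal_sup_ubound; right; exists x.
Qed.

Lemma sup_row_sums_le (M : \bar R) : (0 <= M)%E ->
  (forall x (A : {fset X}), (\sum_(y <- A) modulus (p x y))%:E <= M)%E -> (sup_row_sums p <= M)%E.
Proof.
move=> M0 pM; apply: ge_ereal_sup => _ [->//|[x _ <-]].
exact: esum_le_fset_sum.
Qed.

Lemma sup_row_sums_lty : (sup_row_sums p < +oo)%E ->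
  exists S, [/\ sup_row_sums p = S%:E, 0 <= S & forall x, summable_by (p x) S].
Proof.
have := sup_row_sums_ge0; case e : (sup_row_sums p) => [S| |]//; rewrite lee_fin => S0 _.
by exists S; split=> // x A; rewrite -lee_fin -e le_sup_row_sums.
Qed.

Lemma bounded_of_modulus_le f M : (forall x, modulus (f x) <= M) -> f \in @bounded_pred R k X.
Proof. by move=> fM; apply/asboolP/bounded_modulusP; exists M. Qed.

Section bounded_rows.
Variable S : R.
Hypotheses (S0 : 0 <= S) (rowS : forall x, summable_by (p x) S).

Lemma summable_row_linfty (u : linfty R k X) x :
  summable_by (fun y => p x y * u y) (S * supnorm u).
Proof.
apply: summable_byM (rowS x) (supnorm_ge0 u) => y; exact: modulus_le_supnorm.
Qed.

Lemma trans_op_linfty_bound (u : linfty R k X) x :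
  modulus (trans_op p u x) <= S * supnorm u.
Proof. exact: modulus_total_sum_le (summable_row_linfty u x). Qed.

Definition trans_linfty (u : linfty R k X) : linfty R k X :=
  Linfty (bounded_of_modulus_le (trans_op_linfty_bound u)).

Fact trans_linfty_is_linear : linear trans_linfty.
Proof.
move=> c u v; apply/val_inj/funext => x /=.
rewrite -[RHS](total_sum_linear c (summable_row_linfty u x) (summable_row_linfty v x)).
congr summability.sum; apply/funext => y /=.
by rewrite mulrDr mulrCA.
Qed.

HB.instance Definition _ :=
  GRing.isLinear.Build K (linfty R k X) (linfty R k X) *:%R trans_linfty
    trans_linfty_is_linear.

Lemma supnorm_trans_linfty (u : linfty R k X) : supnorm (trans_linfty u) <= S * supnorm u.
Proof.
by apply: supnorm_le => [|x]; [rewrite mulr_ge0 ?supnorm_ge0|exact: trans_op_linfty_bound].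
Qed.

Lemma continuous_trans_linfty : continuous trans_linfty.
Proof.
apply: bounded_linear_continuous; apply/linear_boundedP.
exists (of_real k S); split; first exact: of_real_real.
move=> r Sr u; apply: (@le_trans _ _ (of_real k S * `|u|)); last first.
  by rewrite ler_wpM2r// ltW.
by rewrite -of_realM ler_of_real supnorm_trans_linfty.
Qed.

Lemma trans_linfty_restricts : trans_op_restricts_to p trans_linfty.
Proof.
split=> // f fb; apply/trans_dom_summable => x.
have fP : f \in @bounded_pred R k X by apply/asboolP.
by exists (S * supnorm (Linfty fP)); exact: (summable_row_linfty (Linfty fP)).
Qed.

(** The row sum at [x] is a lower bound for the operator norm, witnessed by the
    phase of that row. *)
Lemma trans_linfty_phase x : exists2 u : linfty R k X, supnorm u <= 1 &
  forall A : {fset X}, \sum_(y <- A) modulus (p x y) <= supnorm (trans_linfty u).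
Proof.
have u1 y : modulus (phase (p x y)) <= 1 := modulus_phase (p x y).
exists (Linfty (bounded_of_modulus_le u1)); first exact: supnorm_le.
set u := Linfty _ => A.
exact: le_trans (sum_modulus_le_phase A (rowS x)) (modulus_le_supnorm (trans_linfty u) x).
Qed.

Lemma opnorm_trans_linfty : sup_row_sums p = S%:E -> opnorm trans_linfty = S%:E.
Proof.
move=> pS; apply/eqP; rewrite eq_le; apply/andP; split.
  apply: ge_ereal_sup => _ [u /= u1 <-]; rewrite lee_fin.
  by rewrite (le_trans (supnorm_trans_linfty u))// ler_piMr.
rewrite -pS; apply: sup_row_sums_le => [|x A].
  apply: (@le_trans _ _ (supnorm (trans_linfty 0))%:E); first by rewrite lee_fin supnorm_ge0.
  apply: ereal_sup_ubound; exists 0 => //=.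
  by apply: supnorm_le => // x; rewrite modulus0.
have [u u1 uA] := trans_linfty_phase x.
apply: (@le_trans _ _ (supnorm (trans_linfty u))%:E); first by rewrite lee_fin.
by apply: ereal_sup_ubound; exists u.
Qed.

End bounded_rows.

(** A pointwise bounded family of functionals is uniformly bounded. The
    constant 1 gives summable rows, the indicators of points give bounded
    columns, and the gliding hump would contradict unbounded rows. *)
Lemma rows_bounded_of_maps_linfty :
  linfty_set R k X `<=` trans_dom p ->
  trans_op p @` linfty_set R k X `<=` linfty_set R k X ->
  (sup_row_sums p < +oo)%E.
Proof.
move=> dom_p maps_p.
have maps f M : (forall y, modulus (f y) <= M) ->
    exists N, forall x, modulus (trans_op p f x) <= N.
  move=> fM; apply/bounded_modulusP; apply: maps_p; exists f => //.
  by apply/bounded_modulusP; exists M.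
have rows x : exists M, summable_by (p x) M.
  have : linfty_set R k X (cst 1).
    by apply/bounded_modulusP; exists (modulus (1 : K)).
  move=> /dom_p/trans_dom_summable/(_ x)[M pM]; exists M => A.
  by under eq_bigr do rewrite -[p x _]mulr1; exact: pM.
have columns y : exists N, forall x, modulus (p x y) <= N.
  pose delta z : K := (z == y)%:R.
  have /maps[N pN] : forall z, modulus (delta z) <= modulus (1 : K).
    by move=> z; rewrite /delta; case: eqP => //; rewrite modulus0 modulus_ge0.
  exists N => x; have := pN x.
  rewrite /trans_op (@total_sum_single _ _ _ _ y) ?/delta ?eqxx ?mulr1// => z zy.
  by rewrite (negbTE zy) mulr0.
have [[S pS]|unbounded] := pselect (exists S, forall x, summable_by (p x) S).
  (* The maximum matters only for X empty, where S may be negative. *)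
  apply: le_lt_trans (ltry (Num.max 0 S)); apply: sup_row_sums_le => [|x A].
    by rewrite lee_fin le_max lexx.
  by rewrite lee_fin le_max pS orbT.
have unb S : exists x (A : {fset X}), S < \sum_(y <- A) modulus (p x y).
  apply: contrapT => none; apply: unbounded; exists S => x A.
  by rewrite leNgt; apply/negP => SA; apply: none; exists x, A.
have [u [u1 pu]] := gliding_hump rows columns unb.
have [N uN] := maps _ _ u1.
have [x] := pu (Num.bound N).
have N0 : 0 <= N by rewrite (le_trans _ (uN x))// modulus_ge0.
by move=> /le_trans/(_ (uN x)); rewrite leNgt archi_boundP.
Qed.

End operator.

Theorem theorem2p1 (R : realType) (k : scalar_kind) (X : countType)
    (p : X -> X -> scalar_field R k) :
  let cont_linear_op :=
    exists T : {linear linfty R k X -> linfty R k X},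
      continuous T /\ trans_op_restricts_to p T in
  let row_sums_bounded := (sup_row_sums p < +oo)%E in
  let maps_linfty_to_linfty :=
    linfty_set R k X `<=` trans_dom p /\
    trans_op p @` linfty_set R k X `<=` linfty_set R k X in
  [/\ cont_linear_op <-> row_sums_bounded,
      row_sums_bounded <-> maps_linfty_to_linfty &
      cont_linear_op \/ row_sums_bounded \/ maps_linfty_to_linfty ->
      exists T : {linear linfty R k X -> linfty R k X},
        [/\ continuous T, trans_op_restricts_to p T &
            opnorm T = sup_row_sums p]].
Proof.
move=> cont_linear_op row_sums_bounded maps_linfty_to_linfty.
have maps_of_op : cont_linear_op -> maps_linfty_to_linfty.
  move=> [T [_ [dom_p TE]]]; split=> // _ [f fb <-].
  have fP : f \in @bounded_pred R k X by apply/asboolP.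
  rewrite -[f]/(Linfty fP : X -> _) -TE.
  exact/asboolP/linfty_valP.
have rows_of_maps : maps_linfty_to_linfty -> row_sums_bounded.
  by case; exact: rows_bounded_of_maps_linfty.
have op_of_rows : row_sums_bounded -> exists T : {linear linfty R k X -> linfty R k X},
    [/\ continuous T, trans_op_restricts_to p T & opnorm T = sup_row_sums p].
  move=> /sup_row_sums_lty[S [pS S0 rowS]].
  exists (trans_linfty rowS); split.
  - exact: continuous_trans_linfty.
  - exact: trans_linfty_restricts.
  - by rewrite pS opnorm_trans_linfty.
have cont_of_rows : row_sums_bounded -> cont_linear_op.
  by move=> /op_of_rows[T [cT pT _]]; exists T.
split; first by split=> [/maps_of_op/rows_of_maps|/cont_of_rows].
  by split=> [/cont_of_rows/maps_of_op|/rows_of_maps].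
move=> h; apply: op_of_rows; case: h => [/maps_of_op/rows_of_maps//|[//|/rows_of_maps//]].
Qed.
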